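(* Let $K$ be a (not necessarily commutative) field that is a subfield of a ring $R$ with $1$, with $1_K=1_R$. Let $u\in R^*$, $\omega=\begin{pmatrix}u&0\\0&u\end{pmatrix}$, let $C$ be the standard block, $B=C^\omega$, and let $\alpha:R\to R$, $x\mapsto u^{-1}xu$. Then the following statements hold: (a) The fields $K$ and $u^{-1}Ku$ are isomorphic subfields of $R$. The associated affine spaces $\mathbb{A}(K,R)$ and $\mathbb{A}(u^{-1}Ku,R)$ are isomorphic via the semilinear bijection $\alpha$. (b) The incidence structure $(\mathbb{P}_\infty,[B]_\infty)$ is a partial affine space in the affine space $\mathbb{A}(u^{-1}Ku,R)$. (c) The isomorphism $\alpha:\mathbb{A}(K,R)\to\mathbb{A}(u^{-1}Ku,R)$ of affine spaces induces the isomorphism $\omega|_{\mathbb{P}_\infty}:(\mathbb{P}_\infty,[C]_\infty)\to(\mathbb{P}_\infty,[B]_\infty)$ of partial affine spaces.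
   Context: $R$ is an associative ring with $1$, and $R^*$ denotes its group of units; ''field'' means not necessarily commutative field (division ring). $K$ need not be central in $R$. $\Gamma:=\mathrm{GL}_2(R)$ acts from the right on the free left $R$-module $R^2$ (row vectors). The projective line over $R$ is $\mathbb{P}(R):=R(1,0)^\Gamma$. The standard chain $\mathcal{C}$ is the image of $\mathbb{P}(K)$ in $\mathbb{P}(R)$ under $K(k,l)\mapsto R(k,l)$. The chain set is $\mathfrak{C}(K,R):=\mathcal{C}^\Gamma$, and its elements are called chains. Points $R(a,b)$, $R(c,d)$ are distant if $\begin{pmatrix}a&b\\c&d\end{pmatrix}\in\Gamma$. Put $\infty:=R(1,0)$, and let $\mathfrak{C}(\infty)$ be the set of chains containing $\infty$. Let $\mathbb{P}_\infty$ be the set of points distant from $\infty$; thus $\mathbb{P}_\infty=\{R(x,1)\mid x\in R\}$, and $\mathbb{P}_\infty$ is identified with $R$ via $R(x,1)\leftrightarrow x$. The blocks are the elements of $\mathfrak{C}_\infty:=\{\mathcal{D}\setminus\{\infty\}\mid\mathcal{D}\in\mathfrak{C}(\infty)\}$. The standard block is $C:=\mathcal{C}\setminus\{\infty\}$. Let $\Delta:=\{\begin{pmatrix}a&0\\c&1\end{pmatrix}\mid a\in R^*,c\in R\}$. Chains $\mathcal{B},\mathcal{D}\in\mathfrak{C}(\infty)$ are compatible at $\infty$ if they belong to the same orbit of $\Delta$ on $\mathfrak{C}(\infty)$. Blocks $B,D\in\mathfrak{C}_\infty$ are compatible (at $\infty$) if the chains $B\cup\{\infty\}$ and $D\cup\{\infty\}$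 are compatible at $\infty$. $[B]_\infty$ denotes the compatibility class of the block $B$, i.e. the set of all blocks compatible with $B$. For a subfield $L$ of $R$ (with $1_L=1_R$), $\mathbb{A}(L,R)$ denotes the affine space of the left vector space $R$ over $L$: its points are the elements of $R$, its lines are the sets $Lx+y$ with $x,y\in R$, $x\neq 0$. A partial affine space in an affine space is an incidence structure with the same point set that results from the affine space by removing certain (possibly no) parallel classes of lines. *)

(* Defs.v *)
From HB Require Import structures.
From mathcomp Require Import all_boot all_order all_algebra.
From mathcomp Require Import boolp classical_sets functions.

Set Implicit Arguments.
Unset Strict Implicit.
Unset Printing Implicit Defensive.

Import GRing.Theory.
Local Open Scope classical_set_scope.
Local Open Scope ring_scope.

(* R is a not necessarily commutative ring, and subrings (in particular
   fields K, L) are sets of elements of R.  A point of the projective line is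
   a submodule of R^2, i.e. a set of row vectors; a chain or block is a set of
   points. *)

Section Subfields.
Variable R : unitRingType.
Implicit Types (K L : set R) (f phi : R -> R).

(* divring_closed alone is too weak: the inverse of a non-unit x is x. *)
Definition is_subfield K : Prop :=
  GRing.divring_closed [in K] /\
  (forall x : R, K x -> x != 0 -> x \is a GRing.unit).

Definition field_iso K L phi : Prop :=
  [/\ set_bij K L phi,
      phi 1 = 1,
      forall x y : R, K x -> K y -> phi (x + y) = phi x + phi y
    & forall x y : R, K x -> K y -> phi (x * y) = phi x * phi y].

Definition semilinear_bij K L f : Prop :=
  [/\ bijective f,
      {morph f : x y / x + y}
    & exists2 phi : R -> R, field_iso K L phi
      & forall k x : R, K k -> f (k * x) = phi k * f x].

End Subfields.

Record incidence_structure (T : Type) := IncidenceStructure {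
  points : set T;
  lines : set (set T)
}.

Definition incidence_iso (T U : Type) (I : incidence_structure T)
    (J : incidence_structure U) (f : T -> U) : Prop :=
  set_bij (points I) (points J) f /\
  [set f @` l | l in lines I] = lines J.

Section AffineSpaces.
Variable R : unitRingType.
Implicit Types (L : set R) (l m : set R).

Definition affine_line L (x y : R) : set R := [set k * x + y | k in L].

Definition parallel_class L (x : R) : set (set R) :=
  [set affine_line L x y | y in [set: R]].

Definition parallel_classes L : set (set (set R)) :=
  [set parallel_class L x | x in [set x : R | x != 0]].

Definition parallel L l m : Prop :=
  exists2 c, parallel_classes L c & c l /\ c m.

Definition affine_space L : incidence_structure R :=
  IncidenceStructure [set: R]
    [set l | exists x y : R, x != 0 /\ l = affine_line L x y].

(* Parallelism is required explicitly because over the field with two elements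
   it is not determined by the lines, which have only two points each. *)
Definition affine_iso L L' (f : R -> R) : Prop :=
  incidence_iso (affine_space L) (affine_space L') f /\
  (forall l m, lines (affine_space L) l -> lines (affine_space L) m ->
     (parallel L l m <-> parallel L' (f @` l) (f @` m))).

Definition partial_affine_space L (I : incidence_structure R) : Prop :=
  points I = points (affine_space L) /\
  exists2 S : set (set (set R)), S `<=` parallel_classes L
    & lines I = lines (affine_space L) `\` \bigcup_(c in S) c.

End AffineSpaces.

Section ChainGeometry.
Variable R : unitRingType.
Implicit Types (K S : set R) (M N : 'M[R]_2) (p q : set 'rV[R]_2).
Implicit Types (B D : set (set 'rV[R]_2)).

Definition vec2 (a b : R) : 'rV[R]_2 := \row_(j < 2) [:: a; b]`_j.

Definition mat2 (a b c d : R) : 'M[R]_2 :=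
  \matrix_(i < 2) [:: vec2 a b; vec2 c d]`_i.

(* unitmx is only available over commutative rings. *)
Definition GL2 S : set 'M[R]_2 :=
  [set M : 'M[R]_2 | (forall i j, S (M i j)) /\
     exists N : 'M[R]_2, [/\ forall i j, S (N i j), M *m N = 1%:M & N *m M = 1%:M]].

Definition Gamma : set 'M[R]_2 := GL2 [set: R].

Definition span1 S (v : 'rV[R]_2) : set 'rV[R]_2 := [set s *: v | s in S].

Definition point_act M p : set 'rV[R]_2 := [set v *m M | v in p].

Definition chain_act M D : set (set 'rV[R]_2) := [set point_act M p | p in D].

(* For a subring S of R this is the projective line over S, consisting of
   S-submodules of S^2; the projective line over R is the case S = R. *)
Definition projective_line S : set (set 'rV[R]_2) :=
  [set point_act M (span1 S (vec2 1 0)) | M in GL2 S].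

Definition Rpoint (a b : R) : set 'rV[R]_2 := span1 [set: R] (vec2 a b).

Definition standard_chain K : set (set 'rV[R]_2) :=
  [set p | exists k l : R,
     projective_line K (span1 K (vec2 k l)) /\ p = Rpoint k l].

Definition chains K : set (set (set 'rV[R]_2)) :=
  [set chain_act M (standard_chain K) | M in Gamma].

(* Existential over representatives: when R is not Dedekind-finite, a point
   also has generators that are not a row of any invertible matrix. *)
Definition distant p q : Prop :=
  exists a b c d : R,
    [/\ p = Rpoint a b, q = Rpoint c d & Gamma (mat2 a b c d)].

Definition infty : set 'rV[R]_2 := Rpoint 1 0.

Definition P_infty : set (set 'rV[R]_2) :=
  [set p | projective_line [set: R] p /\ distant p infty].

(* The identification of R with P_infty. *)
Definition affine_point (x : R) : set 'rV[R]_2 := Rpoint x 1.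

Definition chains_at_infty K : set (set (set 'rV[R]_2)) :=
  [set D | chains K D /\ D infty].

Definition blocks K : set (set (set 'rV[R]_2)) :=
  [set D `\ infty | D in chains_at_infty K].

Definition standard_block K : set (set 'rV[R]_2) := standard_chain K `\ infty.

Definition Delta : set 'M[R]_2 :=
  [set M | exists a c : R, a \is a GRing.unit /\ M = mat2 a 0 c 1].

Definition compatible_chains K B D : Prop :=
  [/\ chains_at_infty K B, chains_at_infty K D
    & exists2 M, Delta M & D = chain_act M B].

Definition compatible_blocks K B D : Prop :=
  [/\ blocks K B, blocks K D
    & compatible_chains K (B `|` [set infty]) (D `|` [set infty])].

Definition compatibility_class K B : set (set (set 'rV[R]_2)) :=
  [set D | compatible_blocks K B D].

Definition block_structure K B : incidence_structure (set 'rV[R]_2) :=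
  IncidenceStructure P_infty (compatibility_class K B).

Definition partial_affine_in (L : set R)
    (J : incidence_structure (set 'rV[R]_2)) : Prop :=
  exists2 I : incidence_structure R, partial_affine_space L I
    & incidence_iso I J affine_point.

End ChainGeometry.

(* Main.v *)
Require Import Defs.
From HB Require Import structures.
From mathcomp Require Import all_boot all_order all_algebra.
From mathcomp Require Import boolp classical_sets functions.

Set Implicit Arguments.
Unset Strict Implicit.
Unset Printing Implicit Defensive.

Import GRing.Theory.
Local Open Scope classical_set_scope.
Local Open Scope ring_scope.

(** The point R(x,1) is identified with x, and two facts about lower
    triangular matrices with unit diagonal a, d then carry everything: such a
    matrix fixes the point R(1,0), and it acts on the points distant from
    R(1,0) as x |-> d^-1 (x a + c).

    The standard chain consists of R(1,0) and the points of K, because over a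
    division ring every admissible pair (k,l) can be normalised to (1,0) or to
    (l^-1 k,1).  Hence the standard block is K, and the block of omega is
    u^-1 K u.  The group Delta acts on R by x |-> x a + c with a a unit; so, for
    every subset L of R which is a block, the compatibility class of L
    consists exactly of the sets L a + c with a a unit ([compatibility_classE]).
    For a subfield L these are the lines of A(L,R) whose direction is generated
    by a unit.  If L x + y = L a + c then x is an L-multiple of a; therefore being
    a unit depends only on the parallel class, and the lines obtained are those
    of A(L,R) without the parallel classes of the non-unit directions
    ([partial_affine_unit_lines]).  Part (b) is the case L = u^-1 K u, and the
    same result for L = K gives the source of the isomorphism in (c).

    Finally, omega acts on R as the conjugation by u.  This is a ring
    automorphism, so it carries K x + y to (u^-1 K u) x' + y', preserves units,
    and maps the lines of each kind over K onto those over u^-1 K u. *)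

(** * Subfields *)

Section Subfield.
Context {R : unitRingType} {K : set R}.
Hypothesis hK : is_subfield K.

Lemma subfield1 : K 1.
Proof. by case: hK => -[/set_mem]. Qed.

Lemma subfieldB x y : K x -> K y -> K (x - y).
Proof.
by case: hK => -[_ KB _] _ Kx Ky; apply/set_mem/KB; apply/mem_set.
Qed.

Lemma subfield0 : K 0.
Proof. by rewrite -(subrr 1); apply: subfieldB; exact: subfield1. Qed.

Lemma subfield_div x y : K x -> K y -> K (x / y).
Proof.
by case: hK => -[_ _ KV] _ Kx Ky; apply/set_mem/KV; apply/mem_set.
Qed.

Lemma subfieldV x : K x -> K x^-1.
Proof.
by move=> Kx; rewrite -(mul1r x^-1); apply: subfield_div => //; exact: subfield1.
Qed.

Lemma subfieldM x y : K x -> K y -> K (x * y).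
Proof. by move=> Kx Ky; rewrite -(invrK y); apply/subfield_div/subfieldV. Qed.

Lemma subfieldN x : K x -> K (- x).
Proof. by move=> Kx; rewrite -sub0r; apply/subfieldB/Kx/subfield0. Qed.

Lemma subfield_unit x : K x -> x != 0 -> x \is a GRing.unit.
Proof. by case: hK => _; exact. Qed.

End Subfield.

(** * Conjugation by a unit *)

Section Conjugation.
Context {R : unitRingType}.

Definition conjr (u x : R) : R := u^-1 * x * u.

Definition conjr_set (u : R) (K : set R) : set R := conjr u @` K.

Context {u : R}.
Hypothesis hu : u \is a GRing.unit.

Lemma conjrK : cancel (conjr u) (conjr u^-1).
Proof. by move=> x; rewrite /conjr invrK !mulrA divrr // mul1r mulrK. Qed.

Lemma conjVrK : cancel (conjr u^-1) (conjr u).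
Proof. by move=> x; rewrite /conjr invrK !mulrA mulVr // mul1r mulrVK. Qed.

Lemma conjr1 : conjr u 1 = 1.
Proof. by rewrite /conjr mulr1 mulVr. Qed.

Lemma conjrD x y : conjr u (x + y) = conjr u x + conjr u y.
Proof. by rewrite /conjr mulrDr mulrDl. Qed.

Lemma conjrB x y : conjr u (x - y) = conjr u x - conjr u y.
Proof. by rewrite /conjr mulrBr mulrBl. Qed.

Lemma conjrM x y : conjr u (x * y) = conjr u x * conjr u y.
Proof. by rewrite /conjr !mulrA mulrK. Qed.

Lemma conjr_unit x : (conjr u x \is a GRing.unit) = (x \is a GRing.unit).
Proof. by rewrite /conjr unitrMl // unitrMr // unitrV. Qed.

Lemma conjr_eq0 x : (conjr u x == 0) = (x == 0).
Proof.
have c0 : conjr u 0 = 0 by rewrite /conjr mulr0 mul0r.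
by rewrite -[in LHS]c0 (inj_eq (can_inj conjrK)).
Qed.

Lemma conjrV x : x \is a GRing.unit -> conjr u x^-1 = (conjr u x)^-1.
Proof.
move=> xU; have cU : conjr u x \is a GRing.unit by rewrite conjr_unit.
by apply: (mulIr cU); rewrite -conjrM !mulVr // conjr1.
Qed.

Lemma is_subfield_conjr K : is_subfield K -> is_subfield (conjr_set u K).
Proof.
move=> hK; split; first split.
- by apply/mem_set; exists 1; [exact: subfield1 hK | exact: conjr1].
- move=> _ _ /set_mem[x Kx <-] /set_mem[y Ky <-]; apply/mem_set.
  by exists (x - y); [exact: (subfieldB hK) | exact: conjrB].
- move=> _ _ /set_mem[x Kx <-] /set_mem[y Ky <-]; apply/mem_set.
  exists (x / y); first exact: (subfield_div hK).
  (* For y = 0 the quotient is 0 because the inverse of a non-unit is itself. *)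
  rewrite conjrM; have [->|y0] := eqVneq y 0.
    by rewrite invr0 /conjr mulr0 mul0r invr0.
  by rewrite conjrV //; exact: (subfield_unit hK Ky y0).
- move=> _ [x Kx <-]; rewrite conjr_eq0 conjr_unit.
  exact: (subfield_unit hK Kx).
Qed.

Lemma field_iso_conjr K : field_iso K (conjr_set u K) (conjr u).
Proof.
split.
- split=> [x Kx|x y _ _|//]; first by exists x.
  exact: can_inj conjrK _ _.
- exact: conjr1.
- by move=> x y _ _; exact: conjrD.
- by move=> x y _ _; exact: conjrM.
Qed.

Lemma semilinear_bij_conjr K : semilinear_bij K (conjr_set u K) (conjr u).
Proof.
split.
- exact: Bijective conjrK conjVrK.
- exact: conjrD.
- by exists (conjr u); [exact: field_iso_conjr | move=> k x _; exact: conjrM].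
Qed.

Lemma conjr_affine_line K x y :
  conjr u @` affine_line K x y
  = affine_line (conjr_set u K) (conjr u x) (conjr u y).
Proof.
rewrite /affine_line /conjr_set !image_comp; apply: eq_imagel => k _ /=.
by rewrite conjrD conjrM.
Qed.

(** The direction [conjr u x] is no restriction on a parallel class of the
    second space, since conjugation is onto. *)
Lemma conjr_parallel_class K x l :
  parallel_class (conjr_set u K) (conjr u x) (conjr u @` l)
  <-> parallel_class K x l.
Proof.
split=> [[y _ e]|[y _ <-]].
  exists (conjr u^-1 y) => //; apply/predeqP => z.
  rewrite -!(image_inj (can_inj conjrK) (a := z)) -e.
  by rewrite conjr_affine_line conjVrK.
by exists (conjr u y) => //; rewrite conjr_affine_line.
Qed.

Lemma affine_iso_conjr K : affine_iso K (conjr_set u K) (conjr u).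
Proof.
split.
  split.
    split=> // [x y _ _|y _]; first exact: can_inj conjrK _ _.
    by exists (conjr u^-1 y) => //; exact: conjVrK.
  apply/seteqP; split=> [_ [_ [x [y [x0 ->]]] <-]|_ [x [y [x0 ->]]]].
    by exists (conjr u x), (conjr u y); rewrite conjr_eq0 conjr_affine_line.
  exists (affine_line K (conjr u^-1 x) (conjr u^-1 y)).
    exists (conjr u^-1 x), (conjr u^-1 y); split=> //.
    by rewrite -conjr_eq0 conjVrK.
  by rewrite conjr_affine_line !conjVrK.
move=> l m _ _; split=> [[_ [x x0 <-] [cl cm]]|[_ [x x0 <-] []]].
  exists (parallel_class (conjr_set u K) (conjr u x)).
    by exists (conjr u x) => //=; rewrite conjr_eq0.
  by split; apply/conjr_parallel_class.
rewrite -(conjVrK x) => /conjr_parallel_class cl /conjr_parallel_class cm.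
exists (parallel_class K (conjr u^-1 x)) => //.
by exists (conjr u^-1 x) => //=; rewrite -conjr_eq0 conjVrK.
Qed.

End Conjugation.

(** * Lines in unit directions *)

Section UnitLines.
Context {R : unitRingType}.

Definition unit_lines (L : set R) : set (set R) :=
  [set l | exists a c : R, a \is a GRing.unit /\ l = affine_line L a c].

(** The difference of the points of the line for the coefficients 1 and 0 is x,
    and on the other description of the line it is a multiple of x'. *)
Lemma affine_line_direction (L : set R) x y x' y' : is_subfield L ->
  affine_line L x y = affine_line L x' y' -> exists2 k, L k & x = k * x'.
Proof.
move=> hL e.
have [k Lk ek] : affine_line L x' y' (1 * x + y).
  by rewrite -e; exists 1 => //; exact: subfield1 hL.
have [h Lh eh] : affine_line L x' y' (0 * x + y).
  by rewrite -e; exists 0 => //; exact: subfield0 hL.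
exists (k - h); first exact: subfieldB hL _ _ Lk Lh.
rewrite mulrBl; apply: (addIr y); rewrite -[in LHS](mul1r x) -ek.
by rewrite -[in RHS](add0r y) -[in RHS](mul0r x) -eh addrA subrK.
Qed.

(** A non-zero element of L is a unit, so multiplying a direction by it
    does not change whether the direction is a unit: the lines in non-unit
    directions form full parallel classes, disjoint from the unit lines. *)
Lemma partial_affine_unit_lines (L : set R) : is_subfield L ->
  partial_affine_space L (IncidenceStructure [set: R] (unit_lines L)).
Proof.
move=> hL; split=> //.
exists [set parallel_class L x
       | x in [set x : R | x != 0 /\ x \isn't a GRing.unit]].
  by move=> _ [x [x0 _] <-]; exists x.
apply/seteqP; split=> [_ [a [c [aU ->]]]|l [[x [y [x0 ->]]] notS]].
  have a0 : a != 0 by apply: contraTneq aU => ->; rewrite unitr0.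
  split; first by exists a, c.
  move=> [_ [x [x0 /negP xU] <-] [y _ e]]; apply: xU.
  have [k Lk ea] := affine_line_direction hL (esym e).
  have kU : k \is a GRing.unit.
    apply: (subfield_unit hL) => //.
    by apply: contraNneq a0 => k0; rewrite ea k0 mul0r.
  by rewrite -(unitrMr _ kU) -ea.
exists x, y; split=> //; apply: contrapT => /negP xU; apply: notS.
by exists (parallel_class L x); [exists x | exists y].
Qed.

End UnitLines.

(** * Points and their images under matrices *)

Section Points.
Context {R : unitRingType}.
Implicit Types (S : set R) (M N : 'M[R]_2) (p : set 'rV[R]_2).

Lemma vec2_inj (a b c d : R) : vec2 a b = vec2 c d -> a = c /\ b = d.
Proof.
by move=> /rowP e; have := e 0; have := e 1; rewrite !mxE /= => -> ->.
Qed.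

Lemma scale_vec2 (s a b : R) : s *: vec2 a b = vec2 (s * a) (s * b).
Proof. by apply/rowP => -[[|[|//]] h]; rewrite !mxE. Qed.

Lemma mul_vec2 (a b c d e f : R) :
  vec2 a b *m mat2 c d e f = vec2 (a * c + b * e) (a * d + b * f).
Proof.
by apply/rowP => -[[|[|//]] h]; rewrite !mxE !big_ord_recl big_ord0 !mxE /= addr0.
Qed.

Lemma mul_mat2 (a b c d a' b' c' d' : R) :
  mat2 a b c d *m mat2 a' b' c' d'
  = mat2 (a * a' + b * c') (a * b' + b * d') (c * a' + d * c') (c * b' + d * d').
Proof.
apply/matrixP => -[[|[|//]] h] -[[|[|//]] h'];
by rewrite !mxE !big_ord_recl big_ord0 !mxE /= ?mxE /= addr0.
Qed.

Lemma mat2_1 : mat2 1 0 0 1 = 1%:M :> 'M[R]_2.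
Proof. by apply/matrixP => -[[|[|//]] h] -[[|[|//]] h']; rewrite !mxE /= ?mxE. Qed.

Lemma mat2E M : M = mat2 (M 0 0) (M 0 1) (M 1 0) (M 1 1).
Proof.
apply/matrixP => -[[|[|//]] h] -[[|[|//]] h']; rewrite !mxE /= ?mxE /=;
by congr (M _ _); apply: val_inj.
Qed.

Lemma mat2_inj (a b c d a' b' c' d' : R) :
  mat2 a b c d = mat2 a' b' c' d' -> [/\ a = a', b = b', c = c' & d = d'].
Proof.
move=> /matrixP e.
by have := e 0 0; have := e 0 1; have := e 1 0; have := e 1 1;
   rewrite !mxE /= ?mxE /= => -> -> -> ->.
Qed.

Lemma mat2_over S (a b c d : R) :
  S a -> S b -> S c -> S d -> forall i j, S (mat2 a b c d i j).
Proof.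
by move=> Sa Sb Sc Sd [[|[|//]] h] [[|[|//]] h']; rewrite !mxE /= ?mxE.
Qed.

Lemma Gamma_mul M N : Gamma M -> Gamma N -> Gamma (M *m N).
Proof.
move=> [_ [M' [_ MM' M'M]]] [_ [N' [_ NN' N'N]]]; split=> //.
exists (N' *m M'); split=> //.
  by rewrite mulmxA -(mulmxA M) NN' mulmx1.
by rewrite mulmxA -(mulmxA N') M'M mulmx1.
Qed.

Lemma point_act_span1 S M v : point_act M (span1 S v) = span1 S (v *m M).
Proof.
by rewrite /point_act /span1 image_comp; apply: eq_imagel => s _ /=;
   rewrite -scalemxAl.
Qed.

Lemma point_act_mul M N p : point_act (M *m N) p = point_act N (point_act M p).
Proof. by rewrite /point_act image_comp; apply: eq_imagel => v _ /=; rewrite mulmxA. Qed.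

Lemma chain_act_mul M N D : chain_act (M *m N) D = chain_act N (chain_act M D).
Proof. by rewrite /chain_act image_comp; apply: eq_imagel => p _; exact: point_act_mul. Qed.

Lemma RpointP (a b c d : R) :
  Rpoint a b = Rpoint c d -> exists s, a = s * c /\ b = s * d.
Proof.
move=> e; have : Rpoint a b (vec2 a b) by exists 1 => //; rewrite scale1r.
by rewrite e => -[s _]; rewrite scale_vec2 => /vec2_inj[<- <-]; exists s.
Qed.

Lemma Rpoint_unit (s a b : R) : s \is a GRing.unit ->
  Rpoint (s * a) (s * b) = Rpoint a b.
Proof.
move=> sU; rewrite /Rpoint -scale_vec2; apply/seteqP; split=> _ [t _ <-].
  by exists (t * s) => //; rewrite scalerA.
by exists (t / s) => //; rewrite scalerA mulrVK.
Qed.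

Lemma affine_point_unit (a b : R) : b \is a GRing.unit ->
  Rpoint a b = affine_point (b^-1 * a).
Proof.
move=> bU; rewrite /affine_point -(Rpoint_unit (b^-1 * a) 1 bU).
by rewrite mulr1 mulrA divrr // mul1r.
Qed.

Lemma affine_point_inj : injective (@affine_point R).
Proof. by move=> x y /RpointP[s []]; rewrite mulr1 => -> <-; rewrite mul1r. Qed.

Lemma affine_point_neq_infty (x : R) : affine_point x <> @infty R.
Proof. by move=> /RpointP[s [_ /eqP]]; rewrite mulr0 oner_eq0. Qed.

(** The entries of the inverse (0, 1; 1, -x) stay in S, which makes the same
    matrix serve over K, for the standard chain, and over R, for the points
    distant from infinity. *)
Lemma GL2_mat2_x110 S x : S 0 -> S 1 -> S x -> S (- x) -> GL2 S (mat2 x 1 1 0).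
Proof.
move=> S0 S1 Sx SNx; split; first exact: mat2_over.
exists (mat2 0 1 1 (- x)); split; first exact: mat2_over.
  by rewrite mul_mat2 -mat2_1 !mulr0 !mulr1 !mul1r !mul0r !addr0 add0r subrr.
by rewrite mul_mat2 -mat2_1 !mulr0 !mulr1 !mul1r !mul0r !addr0 !add0r subrr.
Qed.

Lemma projective_line_span1 S x : S 0 -> S 1 -> S x -> S (- x) ->
  projective_line S (span1 S (vec2 x 1)).
Proof.
move=> S0 S1 Sx SNx; exists (mat2 x 1 1 0); first exact: GL2_mat2_x110.
by rewrite point_act_span1 mul_vec2 !mul1r !mul0r !addr0.
Qed.

(** If R(c,d) is R(1,0) then d = 0.  Invertibility of (a, b; c, 0) then forces
    b to be a unit: c has a left inverse t, which kills the entry N 0 0 of the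
    inverse N, and N 1 0 is left as a two-sided inverse of b. *)
Lemma P_inftyE : @P_infty R = @affine_point R @` [set: R].
Proof.
apply/seteqP; split=> [p [_ [a [b [c [d [-> e [_ [N [_]]]]]]]]]|_ [x _ <-]].
  have [s [_ ]] := RpointP (esym e); rewrite mulr0 => d0.
  have [t [tc1 _]] := RpointP e.
  rewrite d0 (mat2E N) !mul_mat2 -mat2_1 !mul0r !mulr0 !addr0.
  move=> /mat2_inj[e1 _ cn0 cn1] /mat2_inj[_ _ _ nb].
  have n0 : N 0 0 = 0 by rewrite -(mul1r (N 0 0)) tc1 -mulrA cn0 mulr0.
  have bU : b \is a GRing.unit.
    by apply/unitrP; exists (N 1 0); split=> //; rewrite -e1 n0 mulr0 add0r.
  by rewrite affine_point_unit //; exists (b^-1 * a).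
split; last by exists x, 1, 1, 0; split=> //; exact: GL2_mat2_x110.
exact: projective_line_span1.
Qed.

Lemma affine_point_bij : set_bij [set: R] (@P_infty R) (@affine_point R).
Proof.
by rewrite P_inftyE; split=> [x _|x y _ _|//]; [exists x | exact: affine_point_inj].
Qed.

End Points.

(** * Blocks and their compatibility classes *)

Section Blocks.
Context {R : unitRingType}.
Implicit Types (K L : set R) (D : set (set 'rV[R]_2)).

(** A vector (k,l) generating a point of the line over K has entries in K,
    not both zero; dividing on the left by l, or by k when l = 0, does not change
    the R-submodule that it generates. *)
Lemma standard_chainE K : is_subfield K ->
  standard_chain K = @affine_point R @` K `|` [set @infty R].
Proof.
move=> hK; have K0 := subfield0 hK; have K1 := subfield1 hK.
apply/seteqP; split=> [_ [k [l [[M [KM [N [_ MN _]]] e] ->]]]|_ [[k Kk <-]|->]].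
- move: e; rewrite point_act_span1 {1}(mat2E M) mul_vec2 !mul1r !mul0r !addr0.
  move=> e.
  have : span1 K (vec2 k l) (vec2 k l) by exists 1 => //; rewrite scale1r.
  rewrite -e => -[s Ks]; rewrite scale_vec2 => /vec2_inj[ek el].
  have Kk : K k by rewrite -ek; exact: (subfieldM hK).
  have Kl : K l by rewrite -el; exact: (subfieldM hK).
  have [l0|l0] := eqVneq l 0; last first.
    left; rewrite affine_point_unit; last exact: (subfield_unit hK Kl l0).
    by exists (l^-1 * k) => //; apply: (subfieldM hK) => //; exact: subfieldV.
  right; have [k0|k0] := eqVneq k 0; last first.
    rewrite /infty -(@Rpoint_unit _ k 1 0) ?mulr1 ?mulr0 ?l0 //.
    exact: (subfield_unit hK Kk k0).
  (* A zero generator would make the first row of M vanish. *)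
  have : span1 K (vec2 (M 0 0) (M 0 1)) (vec2 (M 0 0) (M 0 1)).
    by exists 1 => //; rewrite scale1r.
  rewrite e k0 l0 => -[t _]; rewrite scale_vec2 mulr0 => /vec2_inj[m0 m1].
  move: MN; rewrite (mat2E M) (mat2E N) mul_mat2 -mat2_1 => /mat2_inj[+ _ _ _].
  by rewrite -m0 -m1 !mul0r addr0 => /esym/eqP; rewrite oner_eq0.
- exists k, 1; split=> //; apply: projective_line_span1 => //.
  exact: subfieldN.
- exists 1, 0; split=> //; exists 1%:M; last by rewrite point_act_span1 mulmx1.
  rewrite -mat2_1; split; first exact: mat2_over.
  by exists 1%:M; rewrite mat2_1 mulmx1 -mat2_1; split=> //; exact: mat2_over.
Qed.

Lemma affine_point_infty_disj L : ~ (@affine_point R @` L) (@infty R).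
Proof. by move=> [x _ /affine_point_neq_infty]. Qed.

Lemma setU1_inftyK D : ~ D (@infty R) -> (D `|` [set @infty R]) `\ @infty R = D.
Proof. by move=> nD; apply: setUDK => p [->]. Qed.

Lemma standard_blockE K : is_subfield K ->
  standard_block K = @affine_point R @` K.
Proof.
move=> hK; rewrite /standard_block standard_chainE // setU1_inftyK //.
exact: affine_point_infty_disj.
Qed.

Section LowerTriangular.
Context {a d : R} (c : R).
Hypotheses (aU : a \is a GRing.unit) (dU : d \is a GRing.unit).

(** These matrices include Delta, as the case d = 1, and the scalar matrix of
    a unit u, which need not be central, as the case a = d = u, c = 0. *)
Lemma Gamma_lower : Gamma (mat2 a 0 c d).
Proof.
split=> //; exists (mat2 a^-1 0 (- (d^-1 * c * a^-1)) d^-1).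
split=> //; rewrite mul_mat2 -mat2_1 !mul0r !mulr0 !addr0 !add0r ?divrr ?mulVr //.
  by rewrite mulrN !mulrA divrr // mul1r subrr.
by rewrite mulNr mulrVK // addrC subrr.
Qed.

Lemma lower_infty : point_act (mat2 a 0 c d) (@infty R) = @infty R.
Proof.
rewrite point_act_span1 mul_vec2 !mul1r !mul0r !addr0.
by rewrite -[LHS]/(Rpoint a 0) /infty -(@Rpoint_unit _ a 1 0) // mulr1 mulr0.
Qed.

(** The generator (x a + c, d) of the image has to be divided on the left by d;
    for a scalar matrix this is what produces a conjugation. *)
Lemma lower_affine_point x :
  point_act (mat2 a 0 c d) (affine_point x) = affine_point (d^-1 * (x * a + c)).
Proof.
rewrite -affine_point_unit // point_act_span1 mul_vec2.
by rewrite mulr0 add0r !mul1r.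
Qed.

Lemma lower_block L :
  chain_act (mat2 a 0 c d) (@affine_point R @` L)
  = @affine_point R @` [set d^-1 * (x * a + c) | x in L].
Proof.
rewrite /chain_act !image_comp; apply: eq_imagel => x _ /=.
exact: lower_affine_point.
Qed.

Lemma lower_chain L :
  chain_act (mat2 a 0 c d) (@affine_point R @` L `|` [set @infty R])
  = @affine_point R @` [set d^-1 * (x * a + c) | x in L] `|` [set @infty R].
Proof.
by rewrite /chain_act image_setU image_set1 lower_infty -lower_block.
Qed.

End LowerTriangular.

Lemma chains_act K M D : Gamma M -> chains K D -> chains K (chain_act M D).
Proof.
move=> GM [N GN <-]; exists (N *m M); first exact: Gamma_mul.
exact: chain_act_mul.
Qed.

Lemma chains_affine_point K : is_subfield K ->
  chains K (@affine_point R @` K `|` [set @infty R]).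
Proof.
move=> hK; rewrite -standard_chainE //; exists (mat2 1 0 0 1).
  by apply: Gamma_lower; exact: unitr1.
rewrite mat2_1 /chain_act -[RHS]image_id; apply: eq_imagel => p _.
rewrite /point_act -[RHS]image_id; apply: eq_imagel => v _; exact: mulmx1.
Qed.

Lemma lower_Delta a c L :
  [set 1^-1 * (x * a + c) | x in L] = affine_line L a c.
Proof. by apply: eq_imagel => x _; rewrite invr1 mul1r. Qed.

Lemma blocks_affine_point K L :
  chains K (@affine_point R @` L `|` [set @infty R]) ->
  blocks K (@affine_point R @` L).
Proof.
move=> hL; exists (@affine_point R @` L `|` [set @infty R]).
  by split=> //; right.
by apply/setU1_inftyK/affine_point_infty_disj.
Qed.

(** The chain through infinity of a block determines the block, so the orbit
    of Delta can be computed on affine parts, where Delta acts by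
    x |-> x a + c.  The images are again blocks since Delta lies in Gamma and
    fixes infinity. *)
Lemma compatibility_classE K L :
  chains K (@affine_point R @` L `|` [set @infty R]) ->
  compatibility_class K (@affine_point R @` L)
  = [set @affine_point R @` l | l in unit_lines L].
Proof.
move=> hL; apply/seteqP; split=> [D [_ [E _ DE] [_ _ [_ [a [c [aU ->]]]]]]|].
  rewrite lower_chain ?unitr1 // lower_Delta => eD.
  exists (affine_line L a c); first by exists a, c.
  have nD : ~ D (@infty R) by rewrite -DE => -[_]; exact.
  rewrite -(setU1_inftyK nD) eD setU1_inftyK //.
  exact: affine_point_infty_disj.
move=> _ [_ [a [c [aU ->]]] <-].
have eD := lower_chain c aU (unitr1 R) L; rewrite lower_Delta in eD.
have hD : chains K (@affine_point R @` affine_line L a c `|` [set @infty R]).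
  by rewrite -eD; apply: chains_act => //; apply: Gamma_lower => //; exact: unitr1.
split; [exact: blocks_affine_point | exact: blocks_affine_point | split].
- by split=> //; right.
- by split=> //; right.
- by exists (mat2 a 0 c 1) => //; exists a, c.
Qed.

Lemma partial_affine_block_structure K L : is_subfield L ->
  chains K (@affine_point R @` L `|` [set @infty R]) ->
  partial_affine_in L (block_structure K (@affine_point R @` L)).
Proof.
move=> hL cL; exists (IncidenceStructure [set: R] (unit_lines L)).
  exact: partial_affine_unit_lines.
by split; [exact: affine_point_bij | rewrite /= compatibility_classE].
Qed.

End Blocks.

(** * The scalar matrix of a unit *)

Section Scalar.
Context {R : unitRingType} {u : R}.
Hypothesis hu : u \is a GRing.unit.

Lemma scalar_affine_point x :
  point_act (mat2 u 0 0 u) (affine_point x) = affine_point (conjr u x).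
Proof. by rewrite lower_affine_point // addr0 mulrA. Qed.

Lemma scalar_lower_set (L : set R) :
  [set u^-1 * (x * u + 0) | x in L] = conjr_set u L.
Proof. by apply: eq_imagel => x _; rewrite addr0 mulrA. Qed.

Lemma chains_conjr_set K L :
  chains K (@affine_point R @` L `|` [set @infty R]) ->
  chains K (@affine_point R @` conjr_set u L `|` [set @infty R]).
Proof.
move=> cL; rewrite -scalar_lower_set -lower_chain //.
by apply: chains_act => //; exact: Gamma_lower.
Qed.

Lemma scalar_image_affine_point (l : set R) :
  point_act (mat2 u 0 0 u) @` (@affine_point R @` l)
  = @affine_point R @` (conjr u @` l).
Proof. by rewrite !image_comp; apply: eq_imagel => x _; exact: scalar_affine_point. Qed.

Lemma conjr_unit_lines (L : set R) :
  [set conjr u @` l | l in unit_lines L] = unit_lines (conjr_set u L).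
Proof.
apply/seteqP; split=> [_ [_ [a [c [aU ->]]] <-]|_ [a [c [aU ->]]]].
  by exists (conjr u a), (conjr u c); rewrite conjr_unit // conjr_affine_line.
exists (affine_line L (conjr u^-1 a) (conjr u^-1 c)).
  exists (conjr u^-1 a), (conjr u^-1 c); split=> //.
  by rewrite conjr_unit ?unitrV.
by rewrite conjr_affine_line // !conjVrK.
Qed.

(** Both compatibility classes are images of unit lines, and conjugation by u
    permutes units. *)
Lemma scalar_block_iso K L :
  chains K (@affine_point R @` L `|` [set @infty R]) ->
  incidence_iso (block_structure K (@affine_point R @` L))
    (block_structure K (@affine_point R @` conjr_set u L))
    (point_act (mat2 u 0 0 u)).
Proof.
move=> cL; split.
  rewrite /= P_inftyE; split.
  - by move=> _ [x _ <-]; rewrite scalar_affine_point; exists (conjr u x).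
  - move=> _ _ /set_mem[x _ <-] /set_mem[y _ <-].
    by rewrite !scalar_affine_point => /affine_point_inj/(can_inj (conjrK hu)) ->.
  - move=> _ [x _ <-]; exists (affine_point (conjr u^-1 x)).
      by exists (conjr u^-1 x).
    by rewrite scalar_affine_point conjVrK.
rewrite /= !compatibility_classE //; last exact: chains_conjr_set.
rewrite -conjr_unit_lines !image_comp; apply: eq_imagel => l _.
exact: scalar_image_affine_point.
Qed.

End Scalar.

Theorem theorem4p1 (R : unitRingType) (K : set R) (hK : is_subfield K)
    (u : R) (hu : u \is a GRing.unit) :
  let omega : 'M[R]_2 := mat2 u 0 0 u in
  let C : set (set 'rV[R]_2) := standard_block K in
  let B : set (set 'rV[R]_2) := chain_act omega C in
  let alpha : R -> R := fun x : R => u^-1 * x * u in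
  let Ku : set R := [set u^-1 * k * u | k in K] in
  [/\ (* (a) *)
      [/\ is_subfield Ku,
          exists phi : R -> R, field_iso K Ku phi,
          semilinear_bij K Ku alpha
        & affine_iso K Ku alpha],
      (* (b) *)
      partial_affine_in Ku (block_structure K B)
    & (* (c) *)
      [/\ partial_affine_in K (block_structure K C),
          forall x : R,
            point_act omega (affine_point x) = affine_point (alpha x)
        & incidence_iso (block_structure K C) (block_structure K B)
            (point_act omega)]].
Proof.
move=> omega C B alpha Ku.
have eC : C = @affine_point R @` K by exact: standard_blockE.
have eB : B = @affine_point R @` Ku.
  by rewrite /B eC; exact: scalar_image_affine_point.
have cK := chains_affine_point hK.
have hKu := is_subfield_conjr hu hK.
split.
- split=> //; [|exact: semilinear_bij_conjr|exact: affine_iso_conjr].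
  by exists alpha; exact: field_iso_conjr.
- rewrite eB; apply: partial_affine_block_structure => //.
  exact: chains_conjr_set.
- split; first by rewrite eC; exact: partial_affine_block_structure.
    exact: scalar_affine_point.
  by rewrite eB eC; exact: scalar_block_iso.
Qed.
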